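(* Let $f:\mathbb{R}^{n_z}\times\mathbb{R}^{n_u}\to\mathbb{R}^{n_z}$ be a polynomial map and let $\pi:\mathbb{R}^{n_z}\to\mathbb{R}^{n_u}$ be a feed-forward fully-connected neural network with hidden-layer maps $x^1(z),\dots,x^\ell(z)$ (as defined in the context), so that $\pi(z)=W^\ell x^\ell(z)+b^\ell$. Assume that $z^*=0$ is an equilibrium of the closed-loop system $\dot z=f(z,\pi(z))$, i.e. $f(0,\pi(0))=0$. Let $d_1,\dots,d_{n_d}\in\mathbb{R}[z]$ and let $$D^z=\{z\in\mathbb{R}^{n_z} : d_k(z)\ge 0,\ k=1,\dots,n_d\}$$ be a region containing a neighbourhood of $0$. Let $X=(x,z)$ denote the vector of indeterminates consisting of the system state $z\in\mathbb{R}^{n_z}$ and the neural network states $x=(x^1,\dots,x^\ell)$. Suppose that the input-output properties of the network on $D^z$ are described by polynomials $g_1,\dots,g_p,h_1,\dots,h_q\in\mathbb{R}[X]$, in the sense that for every $z\in D^z$ the point $X=(x^1(z),\dots,x^\ell(z),z)$ satisfies $g_i(X)\ge 0$ for all $i=1,\dots,p$ and $h_j(X)=0$ for all $j=1,\dots,q$. Suppose there exist a polynomial $V\in\mathbb{R}[z]$ with $V(0)=0$, a positive definite polynomial $\rho\in\mathbb{R}[z]$ (that is, $\rho(0)=0$ and $\rho(z)>0$ for $z\neq 0$), sum of squares polynomials $p_1,\dots,p_{n_d}\in\Sigma[X]$ and $s_1,\dots,s_p\in\Sigma[X]$, and polynomials $t_1,\dots,t_q\in\mathbb{R}[X]$ such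 that $$V(z)-\rho(z)\in\Sigma[z],$$ $$-\frac{\partial V}{\partial z}(z)\, f\bigl(z,\,W^\ell x^\ell+b^\ell\bigr)-\sum_{k=1}^{n_d}p_k(X)d_k(z)-\sum_{j=1}^{q}t_j(X)h_j(X)-\sum_{i=1}^{p}s_i(X)g_i(X)\in\Sigma[X].$$ Then the equilibrium $z^*=0$ of the closed-loop system $\dot z=f(z,\pi(z))$ is stable (in the sense of Lyapunov).
   Context: Neural network controller: given weight matrices $W^k\in\mathbb{R}^{n_{k+1}\times n_k}$ and biases $b^k\in\mathbb{R}^{n_{k+1}}$ for $k=0,\dots,\ell$, with $n_0=n_z$ and $n_{\ell+1}=n_u$, and a locally Lipschitz activation function $\phi:\mathbb{R}\to\mathbb{R}$ (e.g. $\phi(v)=\max(0,v)$ (ReLU) or $\phi=\tanh$) applied element-wise, define $x^0(z)=z$, $v^k(z)=W^kx^k(z)+b^k$, $x^{k+1}(z)=\phi(v^k(z))$ for $k=0,\dots,\ell-1$, and $\pi(z)=W^\ell x^\ell(z)+b^\ell$. The closed-loop system (a ''neural feedback loop'') is the continuous-time system $\dot z(t)=f(z(t),u(t))$ with $u(t)=\pi(z(t))$. $\mathbb{R}[X]$ is the set of real polynomials in $X$. $\Sigma[X]$ is the set of sum of squares polynomials, i.e. those of the form $\sum_i r_i(X)^2$ with finitely many $r_i\in\mathbb{R}[X]$; similarly $\mathbb{R}[z]$, $\Sigma[z]$. In the second condition $x$ and $z$ are treated as independent indeterminates, and the control input is represented by the affine expression $W^\ell x^\ell+b^\ell$ in the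 last hidden layer. $\frac{\partial V}{\partial z}$ is the row vector of partial derivatives of $V$. The number $p$ of inequality constraints $g_i$ is not to be confused with the multipliers $p_k$. *)

(* Defs.v *)
From HB Require Import structures.
From mathcomp Require Import all_boot all_order all_algebra.
From mathcomp Require Import all_classical all_reals all_analysis.
(* The notations of mpoly clash with those of MathComp-Analysis: import the
   rest of the file and restate the ones that are used. *)
From mathcomp.multinomials Require mpoly.
Import -(notations) mpoly.
Import numFieldNormedType.Exports.

Set Implicit Arguments.
Unset Strict Implicit.
Unset Printing Implicit Defensive.

Import Order.TTheory GRing.Theory Num.Theory.

Local Open Scope classical_set_scope.
Local Open Scope ring_scope.

Notation "{ 'mpoly' R [ n ] }" := (mpoly.mpoly n R)
  (at level 0, R, n at level 2, format "{ 'mpoly'  R [ n ] }") : type_scope.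

Section Polynomials.
Variable R : realType.

Definition evalc (n : nat) (p : {mpoly R[n]}) (v : 'cV[R]_n) : R :=
  meval (fun i => v i 0) p.

Definition substc (n k : nat) (p : {mpoly R[n]})
    (v : 'cV[{mpoly R[k]}]_n) : {mpoly R[k]} :=
  comp_mpoly [tuple v i 0 | i < n] p.

Definition sos (n : nat) (p : {mpoly R[n]}) : Prop :=
  exists rs : seq {mpoly R[n]}, p = \sum_(r <- rs) r ^+ 2.

Definition posdef (n : nat) (p : {mpoly R[n]}) : Prop :=
  evalc p 0 = 0 /\ forall z, z != 0 -> 0 < evalc p z.

Definition grad (n : nat) (V : {mpoly R[n]}) : 'rV[{mpoly R[n]}]_n :=
  \row_i mderiv i V.

Definition semialg (n nd : nat) (d : 'I_nd -> {mpoly R[n]}) : set 'cV[R]_n :=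
  [set z | forall k, 0 <= evalc (d k) z].

End Polynomials.

Section Network.
Variable R : realType.

(* n k is the width of layer k, so that n 0 is the dimension of the state and
   n l.+1 that of the control input; only the weights W k and biases b k with
   k <= l matter. *)
Variables (l : nat) (n : nat -> nat).
Variables (W : forall k, 'M[R]_(n k.+1, n k)) (b : forall k, 'cV[R]_(n k.+1)).
Variable phi : R -> R.

Fixpoint layer (z : 'cV[R]_(n 0%N)) (k : nat) : 'cV[R]_(n k) :=
  match k with
  | 0%N => z
  | k'.+1 => map_mx phi (W k' *m layer z k' + b k')
  end.

Definition controller (z : 'cV[R]_(n 0%N)) : 'cV[R]_(n l.+1) :=
  W l *m layer z l + b l.

(* The indeterminates X = (x, z) are indexed by the neurons i of the layers
   k = 0, ..., l, where layer 0 stands for z (as x^0(z) = z) and the layers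
   1, ..., l for x = (x^1, ..., x^l). *)
Definition neuron : finType := {k : 'I_l.+1 & 'I_(n k)}.

Definition nX : nat := #|neuron|.

Definition Xlayer (k : 'I_l.+1) : 'cV[{mpoly R[nX]}]_(n k) :=
  \col_i mpolyX R (mnm1 (enum_rank (Tagged (fun k : 'I_l.+1 => 'I_(n k)) i))).

Definition Xz : 'cV[{mpoly R[nX]}]_(n 0%N) := Xlayer ord0.

(* W^l x^l + b^l, where x^l are the indeterminates of the last hidden layer *)
Definition Xu : 'cV[{mpoly R[nX]}]_(n l.+1) :=
  map_mx (@mpolyC nX R) (W l) *m Xlayer ord_max + map_mx (@mpolyC nX R) (b l).

Definition Xpoint (z : 'cV[R]_(n 0%N)) : 'cV[R]_nX :=
  \col_j let t : neuron := enum_val j in layer z (tag t) (tagged t) 0.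

Variable f : 'cV[{mpoly R[n 0%N + n l.+1]}]_(n 0%N).

Definition closed_loop (z : 'cV[R]_(n 0%N)) : 'cV[R]_(n 0%N) :=
  \col_i evalc (f i 0) (col_mx z (controller z)).

(* f(z, W^l x^l + b^l), as a vector of polynomials in X *)
Definition Xf : 'cV[{mpoly R[nX]}]_(n 0%N) :=
  \col_i substc (f i 0) (col_mx Xz Xu).

(* (dV/dz)(z) f(z, W^l x^l + b^l) *)
Definition lie (V : {mpoly R[n 0%N]}) : {mpoly R[nX]} :=
  (map_mx (fun p => substc p Xz) (grad V) *m Xf) 0 0.

End Network.

Section Stability.
Variables (R : realType) (n : nat).

(* z solves z' = F(z) on A; the derivative is relative to A, hence one-sided
   at the end points of an interval. *)
Definition solution_on (F : 'cV[R]_n -> 'cV[R]_n) (A : set R)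
    (z : R -> 'cV[R]_n) : Prop :=
  forall t, A t ->
    (s - t)^-1 *: (z s - z t) @[s --> within A t^'] --> F (z t).

(* Stability is a property of all solutions, including those that are only
   defined on a bounded interval [0, T[; the existence of a solution for all
   t >= 0 is part of it, so that it does not hold vacuously. *)
Definition lyapunov_stable (F : 'cV[R]_n -> 'cV[R]_n) (zs : 'cV[R]_n) : Prop :=
  forall e : R, 0 < e -> exists2 delta : R, 0 < delta &
    forall z0 : 'cV[R]_n, `|z0 - zs| < delta ->
      (exists2 z, z 0 = z0 & solution_on F `[0, +oo[ z) /\
      (forall (T : R) z, z 0 = z0 -> solution_on F `[0, T[ z ->
         forall t, 0 <= t < T -> `|z t - zs| < e).

End Stability.

(* Main.v *)
(* V >= rho is positive away from 0, and evaluating the second certificate at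
   X = (x(z), z) kills the t_j h_j and leaves nonnegative terms, so that the
   derivative of V along the closed-loop field is nonpositive on D^z. Hence a
   trajectory that starts close to 0 with V below its minimum over a small
   sphere cannot reach that sphere.

   Existence of trajectories has to be proved as well. The closed-loop field is
   Lipschitz on bounded sets, so composing it with the coordinatewise clipping
   onto a cube makes it bounded and globally Lipschitz. The Euler scheme with
   step 2^-k then converges on [0, +oo[ and the limit solves the clipped
   equation; the Lyapunov argument keeps this solution inside the cube, where
   clipping changes nothing. *)
Require Import Defs.
From HB Require Import structures.
From mathcomp Require Import all_boot all_order all_algebra.
From mathcomp Require Import all_classical all_reals all_analysis.
From mathcomp.multinomials Require mpoly.
From mathcomp Require Import ring lra.
Import -(notations) mpoly.
Import numFieldNormedType.Exports.

Set Implicit Arguments.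
Unset Strict Implicit.
Unset Printing Implicit Defensive.

Import Order.TTheory GRing.Theory Num.Theory.

Local Open Scope classical_set_scope.
Local Open Scope ring_scope.

(* Joins the completeness and the norm of matrices, declared separately in the
   library, into a complete normed module. *)
HB.instance Definition _ (R : realType) m n := Complete.on 'M[R]_(m, n).

(** * Entries and the maximum norm of matrices *)

Section MatrixNorm.
Context {R : realType} {m n : nat}.
Implicit Types A : 'M[R]_(m, n).

Lemma mx_norm_leP A (r : R) :
  0 <= r -> `|A| <= r <-> forall i j, `|A i j| <= r.
Proof.
move=> r0; rewrite [`|A|]/Num.norm /= mx_normrE; split=> [h i j|h].
  by apply: le_trans h; rewrite (le_bigmax _ (fun p => `|A p.1 p.2|) (i, j)).
by apply/bigmax_leP; split=> // -[i j] _ /=.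
Qed.

Lemma mx_norm_entry A i j : `|A i j| <= `|A|.
Proof. by move: i j; apply/mx_norm_leP. Qed.

End MatrixNorm.

(** * Maps that are Lipschitz on bounded sets *)

Section BoundedLipschitz.
Context {R : realType}.
Implicit Types U : normedModType R.

(** Letting the constant depend on the radius makes the property stable under products and
    composition, hence valid for polynomials. *)
Definition bounded_lipschitz U (W : normedModType R) (G : U -> W) :=
  forall r : R, exists L : R, forall x y, `|x| <= r -> `|y| <= r ->
    `|G x - G y| <= L * `|x - y|.

Lemma bounded_lipschitz_ge0 U (W : normedModType R) (G : U -> W) :
  bounded_lipschitz G -> forall r : R, exists2 L : R, 0 <= L &
    forall x y, `|x| <= r -> `|y| <= r -> `|G x - G y| <= L * `|x - y|.
Proof.
move=> GL r; have [L GrL] := GL r; exists `|L| => // x y xr yr.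
by apply: (le_trans (GrL _ _ xr yr)); rewrite ler_wpM2r// ler_norm.
Qed.

Lemma bounded_lipschitz_bounded U (W : normedModType R) (G : U -> W) :
  bounded_lipschitz G -> forall r : R, exists2 B : R, 0 <= B &
    forall x, `|x| <= r -> `|G x| <= B.
Proof.
(* The radius [|r|] keeps 0 in the ball even for negative [r], so that values can be compared with
   [G 0]. *)
move=> /bounded_lipschitz_ge0 GL r; have [L L0 GrL] := GL `|r|.
exists (`|G 0| + L * `|r|); first by rewrite addr_ge0// mulr_ge0.
move=> x xr; have xr' : `|x| <= `|r| by rewrite (le_trans xr)// ler_norm.
rewrite -[G x](subrK (G 0)) addrC (le_trans (ler_normD _ _))// lerD2l.
rewrite (le_trans (GrL _ _ _ _))// ?normr0// subr0.
by rewrite ler_wpM2l.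
Qed.

Lemma bounded_lipschitz_continuous U (W : normedModType R) (G : U -> W) :
  bounded_lipschitz G -> continuous G.
Proof.
move=> /bounded_lipschitz_ge0 GL x; apply/cvgrPdist_lt => e e0.
have [L L0 GxL] := GL (`|x| + 1).
have L10 : 0 < L + 1 by rewrite ltr_wpDl.
near=> y; have : `|x - y| < 1 by near: y; apply: cvgr_dist_lt.
move=> xy1; have yx : `|y| <= `|x| + 1.
  rewrite -[y](subKr x) (le_trans (ler_normB _ _))// lerD2l.
  by rewrite ltW.
apply: le_lt_trans (GxL _ _ _ yx) _; first by rewrite lerDl.
apply: (@le_lt_trans _ _ ((L + 1) * `|x - y|)).
  by rewrite ler_wpM2r// lerDl.
rewrite mulrC -ltr_pdivlMr//; near: y; apply: cvgr_dist_lt => //.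
exact: divr_gt0.
Unshelve. all: by end_near. Qed.

Lemma bounded_lipschitz_comp U (W X : normedModType R) (G : U -> W)
    (H : W -> X) :
  bounded_lipschitz G -> bounded_lipschitz H -> bounded_lipschitz (H \o G).
Proof.
move=> GL HL r; have [B _ GB] := bounded_lipschitz_bounded GL r.
have [L GrL] := GL r; have [K K0 HBK] := bounded_lipschitz_ge0 HL B.
exists (K * L) => x y xr yr; rewrite -mulrA.
by rewrite (le_trans (HBK _ _ (GB _ xr) (GB _ yr)))// ler_wpM2l// GrL.
Qed.

Lemma bounded_lipschitz_cst U (W : normedModType R) (a : W) :
  bounded_lipschitz (fun _ : U => a).
Proof. by move=> r; exists 0 => x y _ _; rewrite subrr normr0 mul0r. Qed.

Lemma bounded_lipschitz_id U : bounded_lipschitz (@id U).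
Proof. by move=> r; exists 1 => x y _ _; rewrite mul1r. Qed.

Lemma bounded_lipschitzD U (W : normedModType R) (G H : U -> W) :
  bounded_lipschitz G -> bounded_lipschitz H ->
  bounded_lipschitz (fun x => G x + H x).
Proof.
move=> GL HL r; have [L GrL] := GL r; have [K HrK] := HL r.
exists (L + K) => x y xr yr.
by rewrite opprD addrACA mulrDl (le_trans (ler_normD _ _))// lerD// (GrL, HrK).
Qed.

Lemma bounded_lipschitzM U (G H : U -> R) :
  bounded_lipschitz G -> bounded_lipschitz H ->
  bounded_lipschitz (fun x => G x * H x).
Proof.
move=> GL HL r; have [L L0 GrL] := bounded_lipschitz_ge0 GL r.
have [K K0 HrK] := bounded_lipschitz_ge0 HL r.
have [A A0 GA] := bounded_lipschitz_bounded GL r.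
have [B B0 HB] := bounded_lipschitz_bounded HL r.
exists (A * K + L * B) => x y xr yr.
have -> : G x * H x - G y * H y = G x * (H x - H y) + (G x - G y) * H y by ring.
rewrite [leRHS]mulrDl (le_trans (ler_normD _ _))// !normrM -mulrA lerD//.
  by rewrite ler_pM// (GA, HrK).
by rewrite mulrAC ler_pM// (HB, GrL).
Qed.

Lemma bounded_lipschitz_sum U (I : Type) (s : seq I) (G : I -> U -> R) :
  (forall i, bounded_lipschitz (G i)) ->
  bounded_lipschitz (fun x => \sum_(i <- s) G i x).
Proof.
move=> GL; elim: s => [|i s IHs].
  by under eq_fun do rewrite big_nil; exact: bounded_lipschitz_cst.
by under eq_fun do rewrite big_cons; exact: bounded_lipschitzD.
Qed.

Lemma bounded_lipschitz_prod U (I : Type) (s : seq I) (G : I -> U -> R) :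
  (forall i, bounded_lipschitz (G i)) ->
  bounded_lipschitz (fun x => \prod_(i <- s) G i x).
Proof.
move=> GL; elim: s => [|i s IHs].
  by under eq_fun do rewrite big_nil; exact: bounded_lipschitz_cst.
by under eq_fun do rewrite big_cons; exact: bounded_lipschitzM.
Qed.

Lemma bounded_lipschitzX U (G : U -> R) k :
  bounded_lipschitz G -> bounded_lipschitz (fun x => G x ^+ k).
Proof.
move=> GL; elim: k => [|k IHk]; first exact: bounded_lipschitz_cst.
by under eq_fun do rewrite exprS; exact: bounded_lipschitzM.
Qed.

Lemma bounded_lipschitz_entry U m n (G : U -> 'M[R]_(m, n)) i j :
  bounded_lipschitz G -> bounded_lipschitz (fun x => G x i j).
Proof.
move=> GL r; have [L GrL] := GL r; exists L => x y xr yr.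
apply: le_trans (GrL x y xr yr).
by have := mx_norm_entry (G x - G y) i j; rewrite !mxE.
Qed.

Lemma bounded_lipschitz_mx U m n (G : U -> 'M[R]_(m, n)) :
  (forall i j, bounded_lipschitz (fun x => G x i j)) -> bounded_lipschitz G.
Proof.
move=> GL r.
have /choice[L LP] : forall ij : 'I_m * 'I_n, exists L : R, 0 <= L /\
    forall x y, `|x| <= r -> `|y| <= r ->
      `|G x ij.1 ij.2 - G y ij.1 ij.2| <= L * `|x - y|.
  move=> [i j]; have [L ? ?] := bounded_lipschitz_ge0 (GL i j) r.
  by exists L.
(* The sum of the nonnegative entry constants dominates each of them, hence works for the maximum
   norm. *)
exists (\sum_ij L ij) => x y xr yr; apply/mx_norm_leP.
  by rewrite mulr_ge0// sumr_ge0// => ij _; have [] := LP ij.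
move=> i j; rewrite !mxE.
have [_ /(_ x y xr yr) h] := LP (i, j); apply: (le_trans h).
rewrite ler_wpM2r// (bigD1 (i, j))//= lerDl sumr_ge0// => ij _.
by have [] := LP ij.
Qed.

Lemma bounded_lipschitz_evalc U k (p : {mpoly R[k]}) (G : U -> 'cV[R]_k) :
  bounded_lipschitz G -> bounded_lipschitz (fun x => evalc p (G x)).
Proof.
move=> GL; rewrite /evalc; under eq_fun do rewrite mevalE.
apply: bounded_lipschitz_sum => q.
apply: bounded_lipschitzM; first exact: bounded_lipschitz_cst.
apply: bounded_lipschitz_prod => i; apply: bounded_lipschitzX.
exact: bounded_lipschitz_entry.
Qed.

(** Compactness of [[-r, r]] yields one [M] that bounds [phi] and is a Lipschitz constant at
    distances below [1 / M]. For pairs further apart, [1 <= M * |x - y|], so the crude bound [2 * M]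
    on the increment is at most [2 * M ^+ 2 * |x - y|]. *)
Lemma bounded_lipschitz_locally (phi : R -> R) :
  [locally [lipschitz phi v | v in setT]] -> bounded_lipschitz phi.
Proof.
move=> philip r.
have local (x : R) : exists M d : R, [/\ 0 < M, 0 < d & forall y z,
    `|x - y| < d -> `|x - z| < d -> `|phi y - phi z| <= M * `|y - z|].
  have [|M [Mreal PM]] := philip (x, x); first by split.
  (* The estimate holds for every constant above [M]; this one is also positive. *)
  have := PM (`|M| + 1).
  rewrite (le_lt_trans (ler_norm _)) ?ltrDl// => /(_ isT).
  rewrite /dominated_by /within /= => -[[A B] /= [Ax Bx] AB].
  move: Ax Bx => /nbhs_ballP[d1 /= d10 d1A] /nbhs_ballP[d2 /= d20 d2B].
  exists (`|M| + 1), (Num.min d1 d2); split.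
  - by rewrite ltr_wpDl.
  - by rewrite lt_min d10.
  - move=> y z; rewrite !lt_min => /andP[xy _] /andP[_ xz].
    apply: (AB (y, z)) => //; split; [exact: d1A|exact: d2B].
have /compact_near_coveringP cpt := @segment_compact R (- r) r.
(* One parameter serves as bound, Lipschitz constant and inverse radius, so that the near-covering
   form of compactness can be applied with [M] tending to infinity. *)
pose P (M : R) x := `|phi x| <= M /\
  forall y, `|x - y| * M < 1 -> `|phi x - phi y| <= M * `|x - y|.
have [x _|N [_ NP]] := cpt R +oo P _.
  have [M [d [M0 d0 Md]]] := local x.
  (* Points within [d / 2] of such a [y] stay within [d] of [x]. The threshold exceeds the Lipschitz
     constant [M], the bound [|phi x| + M * d] of [phi] near [x], and [2 / d], which forces
     [1 / N < d / 2]. *)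
  exists (ball x (d / 2), [set N | M + `|phi x| + M * d + 2 / d < N]) => /=.
    split; first by apply: nbhsx_ballx; rewrite divr_gt0.
    by apply: nbhs_pinfty_gt; rewrite num_real.
  move=> [y N] [] /=; rewrite /ball /= => xy.
  have Md0 : 0 < M * d by rewrite mulr_gt0.
  have d20 : 0 < 2 / d by rewrite divr_gt0.
  have d2d : d / 2 < d by lra.
  have xx : `|x - x| < d by rewrite subrr normr0.
  have xyd : `|x - y| < d by exact: lt_trans d2d.
  have := normr_ge0 (phi x) => phix N0; split.
    rewrite -[phi y](subrK (phi x)) (le_trans (ler_normD _ _))//.
    have := Md _ _ xyd xx; rewrite (distrC y).
    have : M * `|x - y| <= M * d by rewrite ler_pM2l// ltW.
    lra.
  move=> z; have N'0 : 0 < N by lra.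
  rewrite -ltr_pdivlMr// div1r => yz.
  have {}yz : `|y - z| < d / 2.
    rewrite (lt_trans yz)// -[d / 2]invf_div ltf_pV2 ?posrE//; lra.
  have xz : `|x - z| < d.
    rewrite (le_lt_trans (ler_distD y _ _))// [d]splitr ltrD//.
  rewrite (le_trans (Md _ _ xyd xz))// ler_wpM2r//; lra.
have {NP} [M [M0 MP]] : exists M, 0 < M /\ `[- r, r]%classic `<=` P M.
  exists (Num.max 0 N + 1); split; first by rewrite ltr_wpDl// le_max lexx.
  apply: NP; rewrite (@le_lt_trans _ _ (Num.max 0 N))// ?ltrDl//.
  by rewrite le_max lexx orbT.
exists (M + 2 * M ^+ 2) => x y xr yr.
rewrite ler_norml in xr; rewrite ler_norml in yr.
have [phix xP] := MP x xr; have [phiy _] := MP y yr.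
have Mxy : 0 <= M * `|x - y| by rewrite mulr_ge0// ltW.
rewrite mulrDl -mulrA expr2 -mulrA.
have [xy1|xy1] := ltP (`|x - y| * M) 1.
  by apply: (le_trans (xP _ xy1)); rewrite lerDl mulr_ge0// mulr_ge0// ltW.
rewrite (le_trans (ler_normB _ _))//.
have : M * 1 <= M * (M * `|x - y|) by rewrite ler_pM2l// mulrC.
lra.
Qed.

End BoundedLipschitz.

(** * Global solutions by the Euler scheme *)

Section Euler.
Context {R : realType} {E : completeNormedModType R}.
Variables (F : E -> E) (L M : R) (z0 : E).
Hypothesis L0 : 0 <= L.
Hypothesis F_bounded : forall x, `|F x| <= M.
Hypothesis F_lipschitz : forall x y, `|F x - F y| <= L * `|x - y|.

Let M0 : 0 <= M. Proof. exact: le_trans (F_bounded 0). Qed.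

Let FC : continuous F.
Proof.
apply: bounded_lipschitz_continuous => r; exists L => x y _ _.
exact: F_lipschitz.
Qed.

Definition euler (h : R) (k : nat) : E := iter k (fun x => x + h *: F x) z0.

Lemma euler_dist h j i :
  0 <= h -> `|euler h (j + i) - euler h j| <= i%:R * h * M.
Proof.
move=> h0; elim: i => [|i IHi]; first by rewrite addn0 subrr normr0 !mul0r.
rewrite addnS /= addrAC -natr1 !mulrDl mul1r.
rewrite (le_trans (ler_normD _ _))// lerD//.
by rewrite normrZ ger0_norm// ler_wpM2l.
Qed.

(** During [i] steps the state moves by at most [i * h * M], so the field changes by at most [L]
    times that; each step adds [h] times this change to the error. *)
Lemma euler_taylor h j i : 0 <= h ->
  `|euler h (j + i) - euler h j - (i%:R * h) *: F (euler h j)|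
    <= L * M * (i%:R * h) ^+ 2.
Proof.
move=> h0; elim: i => [|i IHi].
  by rewrite addn0 subrr mul0r scale0r subr0 normr0 expr0n mulr0.
rewrite addnS /= -natr1 [(_ + 1) * h]mulrDl mul1r scalerDl.
rewrite (addrAC (euler h (j + i))) opprD addrACA.
have Mi : 0 <= i%:R * h by rewrite mulr_ge0.
rewrite -scalerBr (le_trans (ler_normD _ _))//.
apply: (@le_trans _ _ (L * M * (i%:R * h) ^+ 2 + h * (L * (i%:R * h * M)))).
  rewrite lerD// normrZ (ger0_norm h0) ler_wpM2l//.
  rewrite (le_trans (F_lipschitz _ _))//.
  by rewrite ler_wpM2l// euler_dist.
have : 0 <= L * M * ((i%:R * h) * h) by rewrite !mulr_ge0.
have : 0 <= L * M * (h * h) by rewrite !mulr_ge0.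
lra.
Qed.

(** A discrete Gronwall estimate: one step multiplies the error by [1 + h * L] and adds at most
    [h ^+ 2 * L * M / 4]. The right-hand side satisfies the same recursion with [h ^+ 2 * L * M]
    added. *)
Lemma euler_refine h j : 0 <= h ->
  `|euler (h / 2) j.*2 - euler h j| <= h * M * ((1 + h * L) ^+ j - 1).
Proof.
move=> h0; elim: j => [|j IHj]; first by rewrite subrr normr0 expr0 subrr mulr0.
rewrite doubleS /=; set w := euler (h / 2) j.*2 in IHj *.
set e := euler h j in IHj *.
set w' := w + (h / 2) *: F w.
(* Old error, effect of the old error on the field, and change of the field over the first half
   step. *)
have -> : w' + (h / 2) *: F w' - (e + h *: F e) =
    (w - e) + h *: (F w - F e) + (h / 2) *: (F w' - F w).
  have -> : h *: (F w - F e) = (h / 2) *: F w + (h / 2) *: F w - h *: F e.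
    by rewrite scalerBr -scalerDl -splitr.
  set a := (h / 2) *: F w; set b := (h / 2) *: F w'; set c := h *: F e.
  have -> : (h / 2) *: (F w' - F w) = b - a by rewrite scalerBr.
  rewrite /w' -/a [a + a - c]addrAC [w - e + _]addrA -[_ + a + (b - a)]addrA.
  by rewrite [a + (b - a)]addrC subrK (addrACA w) opprD; exact: addrAC.
have w'w : `|w' - w| <= h / 2 * M.
  rewrite /w' addrAC subrr add0r normrZ ger0_norm ?divr_ge0//.
  by rewrite ler_wpM2l// divr_ge0.
apply: (@le_trans _ _
  (`|w - e| + h * (L * `|w - e|) + h / 2 * (L * (h / 2 * M)))).
  rewrite (le_trans (ler_normD _ _))// lerD//.
    rewrite (le_trans (ler_normD _ _))// lerD2l normrZ ger0_norm//.
    by rewrite ler_wpM2l.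
  rewrite normrZ ger0_norm ?divr_ge0// ler_wpM2l ?divr_ge0//.
  by rewrite (le_trans (F_lipschitz _ _))// ler_wpM2l.
have hL : 0 <= 1 + h * L by rewrite addr_ge0// mulr_ge0.
have := ler_wpM2l hL IHj.
have : 0 <= h * h * L * M by rewrite !mulr_ge0.
rewrite exprS; set X := _ ^+ j; set D := `|w - e|.
lra.
Qed.

Let h (k : nat) : R := 2^-1 ^+ k.
Let N (k : nat) (t : R) : nat := Num.truncn (t / h k).
(** Piecewise constant in time: no interpolation is made, since the grid times [N k t * h k] tend to
    [t]. *)
Let y (k : nat) (t : R) : E := euler (h k) (N k t).

Let h_gt0 k : 0 < h k. Proof. by rewrite exprn_gt0// invr_gt0. Qed.
Let h_ge0 k : 0 <= h k. Proof. exact: ltW. Qed.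

Let Nh_le k t : 0 <= t -> (N k t)%:R * h k <= t.
Proof.
move=> t0; rewrite -ler_pdivlMr//.
by have /andP[] := truncn_itv (divr_ge0 t0 (h_ge0 k)).
Qed.

Let Nh_gt k t : t < (N k t)%:R * h k + h k.
Proof.
by rewrite -[X in _ + X]mul1r -mulrDl natr1 -ltr_pdivrMr// truncnS_gt.
Qed.

(** Halving the step doubles the number of completed steps, up to one extra. The refinement error
    and that extra step are both of order [h k], which is geometric in [k]. *)
Let y_succ k t : 0 <= t ->
  `|y k.+1 t - y k t| <= (M * expR (L * t) + M) * h k.
Proof.
move=> t0; have hS : h k.+1 = h k / 2 by rewrite /h exprSr.
have N2 : ((N k t).*2 <= N k.+1 t)%N.
  rewrite /N truncn_ge_nat ?divr_ge0// ler_pdivlMr// hS -muln2 natrM.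
  by have := Nh_le k t0; rewrite /N; lra.
have N2' : (N k.+1 t - (N k t).*2 <= 1)%N.
  rewrite leq_subLR -ltnS /N truncn_lt_nat ?divr_ge0// ltr_pdivrMr//.
  rewrite -muln2 addn1 -!natr1 natrM hS.
  by have := Nh_gt k t; rewrite /N; lra.
rewrite /y -(subnKC N2) -[euler (h k.+1) _](subrK (euler (h k.+1) (N k t).*2)).
rewrite -addrA (le_trans (ler_normD _ _))// [leLHS]addrC [leRHS]mulrDl lerD//.
  rewrite hS (le_trans (euler_refine _ (h_ge0 k)))//.
  rewrite [leRHS]mulrAC [M * _]mulrC ler_wpM2l ?mulr_ge0//.
  (* From [1 + x <= exp x] and [N k t * h k <= t], the growth factor is at most [exp (L * t)],
     independently of [k]. *)
  apply: (@le_trans _ _ ((1 + h k * L) ^+ N k t)); first by rewrite gerBl.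
  apply: (@le_trans _ _ (expR (h k * L) ^+ N k t)).
    by rewrite lerXn2r ?nnegrE ?expR_ge0 ?expR_ge1Dx// addr_ge0// mulr_ge0.
  rewrite -expRM_natr ler_expR mulrC mulrA [leRHS]mulrC ler_wpM2r//.
  exact: Nh_le.
rewrite (le_trans (euler_dist _ _ (h_ge0 k.+1)))// mulrC ler_wpM2l//.
rewrite hS (@le_trans _ _ (1 * (h k / 2)))//.
  by rewrite ler_wpM2r ?divr_ge0// lern1.
have := h_ge0 k; lra.
Qed.

(** The increments are dominated by a geometric series, so their sum converges by completeness of
    [E]. *)
Let y_cvg t : 0 <= t -> cvgn (y ^~ t).
Proof.
move=> t0; set C := M * expR (L * t) + M.
have : cvgn (series (telescope (y ^~ t))).
  apply: normed_cvg; apply: (@series_le_cvg _ _ (geometric C 2^-1)) => [k|k|k|].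
  - exact: normr_ge0.
  - by rewrite /geometric /= mulr_ge0// addr_ge0// mulr_ge0// expR_ge0.
  - exact: y_succ.
  - apply: is_cvg_geometric_series; rewrite ger0_norm ?invr_ge0//.
    by rewrite invf_lt1// ltr1n.
rewrite telescopeK => cy.
have -> : y ^~ t = (fun k => (y k t - y 0%N t) + y 0%N t).
  by apply/funext => k; rewrite subrK.
by apply: is_cvgD => //; exact: is_cvg_cst.
Qed.

Definition euler_lim (t : R) : E := limn (y ^~ t).

Let y_lim t : 0 <= t -> y ^~ t @ \oo --> euler_lim t.
Proof. exact: y_cvg. Qed.

Let Nh_cvg t : 0 <= t -> (N k t)%:R * h k @[k --> \oo] --> t.
Proof.
move=> t0.
apply: (@squeeze_cvgr _ _ _ _ (fun k => t - h k) (fun=> t));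
  last exact: cvg_cst.
  near=> k; rewrite Nh_le// andbT lerBlDr ltW//; exact: Nh_gt.
rewrite -[X in _ --> X]subr0; apply: cvgB; first exact: cvg_cst.
by apply: cvg_expr; rewrite ger0_norm ?invr_ge0// invf_lt1// ltr1n.
Unshelve. all: by end_near. Qed.

Let N_le k s t : s <= t -> (N k s <= N k t)%N.
Proof. by move=> st; rewrite le_truncn// ler_wpM2r ?invr_ge0. Qed.

Let NBh_cvg s t : 0 <= s <= t ->
  (N k t - N k s)%N%:R * h k @[k --> \oo] --> t - s.
Proof.
move=> /andP[s0 st].
under eq_fun do rewrite natrB ?N_le// mulrBl.
by apply: cvgB; apply: Nh_cvg => //; exact: le_trans st.
Qed.

Let yB_cvg s t : 0 <= s -> 0 <= t ->
  y k t - y k s @[k --> \oo] --> euler_lim t - euler_lim s.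
Proof.
move=> s0 t0.
exact: (@cvgB _ _ _ _ eventually_filter _ _ _ _ (y_lim t0) (y_lim s0)).
Qed.

Let Fy_cvg t : 0 <= t -> F (y k t) @[k --> \oo] --> F (euler_lim t).
Proof. by move=> t0; apply: (cvg_comp _ _ (y_lim t0)); exact: FC. Qed.

Lemma euler_lim_dist s t : 0 <= s <= t ->
  `|euler_lim t - euler_lim s| <= (t - s) * M.
Proof.
move=> /[dup] st /andP[s0 s_t]; have t0 := le_trans s0 s_t.
apply: (@ler_cvg_to _ \oo _ _ (fun k => `|y k t - y k s|)
  (fun k => (N k t - N k s)%N%:R * h k * M)).
- by apply: cvg_norm; exact: yB_cvg.
- by apply: cvgM; [exact: NBh_cvg|exact: cvg_cst].
- by near=> k; rewrite /y -(subnKC (N_le k s_t)) addKn euler_dist.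
Unshelve. all: by end_near. Qed.

(* A second-order Taylor bound survives the limit, so the derivative of the
   limit is obtained without integrals. *)
Lemma euler_lim_taylor s t : 0 <= s <= t ->
  `|euler_lim t - euler_lim s - (t - s) *: F (euler_lim s)|
    <= L * M * (t - s) ^+ 2.
Proof.
move=> /[dup] st /andP[s0 s_t]; have t0 := le_trans s0 s_t.
apply: (@ler_cvg_to _ \oo _ _
  (fun k => `|y k t - y k s - ((N k t - N k s)%N%:R * h k) *: F (y k s)|)
  (fun k => L * M * ((N k t - N k s)%N%:R * h k) ^+ 2)).
- apply: cvg_norm; apply: (@cvgB _ _ _ _ eventually_filter).
    exact: yB_cvg.
  apply: (@cvgZ _ _ _ _ eventually_filter); first exact: NBh_cvg.
  exact: Fy_cvg.
- apply: cvgM; first exact: cvg_cst.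
  by under eq_fun do rewrite expr2; rewrite expr2; apply: cvgM; exact: NBh_cvg.
- by near=> k; rewrite /y -(subnKC (N_le k s_t)) addKn euler_taylor.
Unshelve. all: by end_near. Qed.

(** The derivative also needs times before the base point. There the expansion is taken at the
    earlier time, and moving the base point of the field costs a second term of the same size,
    whence the factor 2. *)
Lemma euler_lim_taylor2 s t : 0 <= s -> 0 <= t ->
  `|euler_lim t - euler_lim s - (t - s) *: F (euler_lim s)|
    <= 2 * (L * M) * (t - s) ^+ 2.
Proof.
move=> s0 t0; have LM : 0 <= L * M * (t - s) ^+ 2.
  by rewrite mulr_ge0 ?sqr_ge0// mulr_ge0.
have [st|ts] := leP s t.
  rewrite (le_trans (euler_lim_taylor _)) ?s0//; lra.
have ts' : 0 <= t <= s by rewrite t0 ltW.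
have -> : euler_lim t - euler_lim s - (t - s) *: F (euler_lim s) =
    - (euler_lim s - euler_lim t - (s - t) *: F (euler_lim t)) +
    (s - t) *: (F (euler_lim s) - F (euler_lim t)).
  rewrite -scaleNr opprB [in RHS]opprB opprB scalerBr [RHS]addrC addrA subrK.
  exact: addrC.
rewrite (le_trans (ler_normD _ _))// normrN.
have := euler_lim_taylor ts'.
have : `|(s - t) *: (F (euler_lim s) - F (euler_lim t))|
    <= (s - t) * (L * ((s - t) * M)).
  rewrite normrZ gtr0_norm ?subr_gt0// ler_wpM2l ?subr_ge0 ?(ltW ts)//.
  by rewrite (le_trans (F_lipschitz _ _))// ler_wpM2l// euler_lim_dist.
lra.
Qed.

Lemma euler_lim0 : euler_lim 0 = z0.
Proof.
rewrite /euler_lim /y /N; under eq_fun do rewrite mul0r truncn0.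
exact: lim_cst.
Qed.

Lemma euler_lim_derive t : 0 <= t ->
  (s - t)^-1 *: (euler_lim s - euler_lim t) @[s --> within `[0, +oo[ t^']
    --> F (euler_lim t).
Proof.
move=> t0; apply/cvgrPdist_le => e e0.
have K0 : 0 < 2 * (L * M) + 1 by rewrite ltr_wpDl// !mulr_ge0.
rewrite !near_withinE.
near=> s => st; rewrite /= in_itv/= andbT => s0.
have sK : `|t - s| <= e / (2 * (L * M) + 1).
  by near: s; apply: cvgr_dist_le; [exact: cvg_id|exact: divr_gt0].
have st0 : s - t != 0 by rewrite subr_eq0.
rewrite distrC.
have -> : (s - t)^-1 *: (euler_lim s - euler_lim t) - F (euler_lim t) =
    (s - t)^-1 *: (euler_lim s - euler_lim t - (s - t) *: F (euler_lim t)).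
  by rewrite [RHS]scalerBr scalerA mulVf// scale1r.
rewrite normrZ normfV mulrC ler_pdivrMr ?normr_gt0//.
rewrite (le_trans (euler_lim_taylor2 t0 s0))// -real_normK ?num_real//.
rewrite expr2 [leLHS]mulrA ler_wpM2r// distrC.
move: sK; rewrite ler_pdivlMr//; have := normr_ge0 (t - s); lra.
Unshelve. all: by end_near. Qed.

End Euler.

(** * The certificate along trajectories *)

Section Evaluation.
Context {R : realType}.

Lemma evalc_substc n k (p : {mpoly R[n]}) (v : 'cV[{mpoly R[k]}]_n)
    (w : 'cV[R]_k) :
  evalc (substc p v) w = evalc p (\col_i evalc (v i 0) w).
Proof.
rewrite /evalc /substc comp_mpoly_meval; apply: meval_eq => i.
by rewrite tnth_mktuple mxE.
Qed.

Lemma evalc_sos_ge0 n (p : {mpoly R[n]}) v : sos p -> 0 <= evalc p v.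
Proof.
move=> [rs ->]; rewrite /evalc rmorph_sum /=; apply: sumr_ge0 => r _.
by rewrite rmorphXn/= sqr_ge0.
Qed.

Variables (l : nat) (n : nat -> nat).
Variables (W : forall k, 'M[R]_(n k.+1, n k)) (b : forall k, 'cV[R]_(n k.+1)).
Variable phi : R -> R.

Lemma evalc_Xlayer (z : 'cV[R]_(n 0%N)) (k : 'I_l.+1) :
  \col_i evalc (Xlayer R n k i 0) (Xpoint l W b phi z) = layer W b phi z k.
Proof.
apply/colP => i; rewrite !mxE /evalc mevalXU /Xpoint mxE.
by rewrite enum_rankK.
Qed.

Lemma evalc_Xu (z : 'cV[R]_(n 0%N)) :
  \col_i evalc (Xu l W b i 0) (Xpoint l W b phi z) = controller l W b phi z.
Proof.
rewrite /controller -[layer W b phi z l]/(layer W b phi z (@ord_max l)).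
rewrite -evalc_Xlayer; apply/colP => i.
rewrite !mxE /evalc mevalD mevalC; congr (_ + _).
by rewrite rmorph_sum /=; apply: eq_bigr => j _; rewrite !mxE mevalM mevalC.
Qed.

(** Links the certificate, where [x] and [z] are independent, to the dynamics: at the point given by
    the network, [Xu] takes the value of the controller. *)
Lemma evalc_lie (f : 'cV[{mpoly R[n 0%N + n l.+1]}]_(n 0%N))
    (V : {mpoly R[n 0%N]}) (z : 'cV[R]_(n 0%N)) :
  evalc (lie W b f V) (Xpoint l W b phi z) =
  \sum_i evalc (mderiv i V) z * closed_loop W b phi f z i 0.
Proof.
have Xz_z : \col_i evalc (Xz R l n i 0) (Xpoint l W b phi z) = z.
  exact: (evalc_Xlayer z ord0).
rewrite /lie mxE {1}/evalc rmorph_sum /=; apply: eq_bigr => i _.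
rewrite !mxE mevalM -!/(evalc _ _) !evalc_substc Xz_z; congr (_ * evalc _ _).
apply/colP => j; rewrite !mxE; case: splitP => k _.
  by rewrite -[in RHS]Xz_z mxE.
by rewrite -evalc_Xu mxE.
Qed.

Lemma bounded_lipschitz_closed_loop
    (f : 'cV[{mpoly R[n 0%N + n l.+1]}]_(n 0%N)) :
  bounded_lipschitz phi -> bounded_lipschitz (closed_loop W b phi f).
Proof.
move=> phiL.
have affineL k (U : normedModType R) (x : U -> 'cV[R]_(n k)) :
    bounded_lipschitz x -> bounded_lipschitz (fun z => W k *m x z + b k).
  move=> xL; apply: bounded_lipschitz_mx => i j; under eq_fun do rewrite !mxE.
  apply: bounded_lipschitzD; last exact: bounded_lipschitz_cst.
  apply: bounded_lipschitz_sum => m; apply: bounded_lipschitzM.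
    exact: bounded_lipschitz_cst.
  exact: bounded_lipschitz_entry.
have layerL k : bounded_lipschitz (fun z => layer W b phi z k).
  elim: k => [|k IHk]; first exact: bounded_lipschitz_id.
  apply: bounded_lipschitz_mx => i j; under eq_fun do rewrite mxE.
  apply: (bounded_lipschitz_comp _ phiL); apply: bounded_lipschitz_entry.
  exact: affineL.
apply: bounded_lipschitz_mx => i j; under eq_fun do rewrite mxE.
apply: bounded_lipschitz_evalc; apply: bounded_lipschitz_mx => k o.
have [m ->|m ->] := split_ordP k.
  under eq_fun do rewrite col_mxEu.
  exact: (bounded_lipschitz_entry _ _ (@bounded_lipschitz_id _ _)).
under eq_fun do rewrite col_mxEd.
apply: bounded_lipschitz_entry; exact: affineL.
Qed.

End Evaluation.

(** * Derivatives along solutions and the first exit argument *)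

Section Trajectories.
Context {R : realType} {n : nat}.
Implicit Types (F : 'cV[R]_n -> 'cV[R]_n) (z : R -> 'cV[R]_n).

Lemma solution_on_sub F (A B : set R) z :
  A `<=` B -> solution_on F B z -> solution_on F A z.
Proof.
move=> AB zB t At; apply: cvg_trans (zB t (AB t At)).
by apply: cvg_app; exact: within_subset.
Qed.

Lemma solution_on_continuous F (A : set R) z :
  solution_on F A z -> {within A, continuous z}.
Proof.
move=> zA; apply/subspace_continuousP => t At; apply/cvgrPdist_lt => e e0.
(* Near [t] the difference quotient is within 1 of [F (z t)], so this number bounds it. *)
have K0 : 0 < `|F (z t)| + 1 by rewrite ltr_wpDl.
have /cvgrPdist_lt/(_ 1 ltr01) := zA t At.
rewrite !near_withinE => zF; near=> s => As.
have [->|st] := eqVneq s t; first by rewrite subrr normr0.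
have st0 : s - t != 0 by rewrite subr_eq0.
have zFs : `|F (z t) - (s - t)^-1 *: (z s - z t)| < 1.
  by move: st As; near: s.
have ste : `|t - s| < e / (`|F (z t)| + 1).
  by near: s; apply: cvgr_dist_lt; [exact: cvg_id|exact: divr_gt0].
have qF : `|(s - t)^-1 *: (z s - z t)| <= `|F (z t)| + 1.
  set q := _ *: _ in zFs *; rewrite -[q](subKr (F (z t))).
  by rewrite (le_trans (ler_normB _ _))// lerD2l ltW.
rewrite distrC -[z s - z t](scalerKV st0) normrZ.
rewrite (le_lt_trans (ler_wpM2l _ qF))// distrC.
by rewrite -ltr_pdivlMr.
Unshelve. all: by end_near. Qed.

(** Around an interior point the interval contains a full neighbourhood, so the relative derivative
    is an ordinary one. *)
Lemma solution_on_is_derive F (a b : R) z t i :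
  solution_on F `[a, b] z -> t \in `]a, b[ ->
  is_derive t 1 (fun s => z s i 0) (F (z t) i 0).
Proof.
move=> zab tab; have tab' : `[a, b]%classic t by apply: subset_itv_oo_cc tab.
suff zhi : h^-1 *: (((fun s => z s i 0) \o shift t) (h *: (1 : R)) - z t i 0)
    @[h --> 0^'] --> F (z t) i 0.
  by apply: DeriveDef; [apply: cvgP zhi|exact: cvg_lim zhi].
apply/cvgrPdist_lt => e e0.
have /cvgrPdist_lt/(_ e e0) := zab t tab'.
rewrite !near_withinE => /nbhs_ballP[d1 /= d10 d1F].
have /nbhs_ballP[d2 /= d20 d2A] := near_in_itvoo tab.
apply/nbhs_ballP; exists (Num.min d1 d2); first by rewrite /= lt_min d10.
move=> h; rewrite /ball /= sub0r normrN lt_min => /andP[hd1 hd2] h0.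
have th : `|t - (h + t)| = `|h| by rewrite opprD addrCA subrr addr0 normrN.
have /subset_itv_oo_cc htab : h + t \in `]a, b[.
  by apply: d2A; rewrite /ball /= th.
have ht : h + t != t by rewrite -subr_eq0 addrK.
have := d1F (h + t); rewrite /ball /= th => /(_ hd1 ht htab).
apply: le_lt_trans; rewrite addrK /= /GRing.scale /= mulr1.
have := mx_norm_entry (F (z t) - h^-1 *: (z (h + t) - z t)) i 0.
by rewrite !mxE.
Qed.

(** The chain rule, obtained algebraically: the polynomials satisfying it include constants and
    variables and are closed under sums and products. *)
Lemma is_derive_evalc (p : {mpoly R[n]}) z (w : 'cV[R]_n) (t : R) :
  (forall i, is_derive t 1 (fun s => z s i 0) (w i 0)) ->
  is_derive t 1 (fun s => evalc p (z s))
    (\sum_i evalc (mderiv i p) (z t) * w i 0).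
Proof.
move=> zw.
pose D q := is_derive t 1 (fun s => evalc q (z s))
  (\sum_i evalc (mderiv i q) (z t) * w i 0).
have DC c : D (mpolyC n c).
  rewrite /D /evalc; under eq_fun do rewrite mevalC.
  rewrite big1 => [|i _]; last by rewrite mderivC meval0 mul0r.
  exact: is_derive_cst.
have DD q q' : D q -> D q' -> D (q + q').
  rewrite /D /evalc => Dq Dq'; under eq_fun do rewrite mevalD.
  under eq_bigr do rewrite mderivD mevalD mulrDl.
  by rewrite big_split /=; exact: is_deriveD.
have DM q q' : D q -> D q' -> D (q * q').
  rewrite /D /evalc => Dq Dq'; under eq_fun do rewrite mevalM.
  under eq_bigr do
    rewrite mderivM mevalD !mevalM mulrDl [_ * meval _ q']mulrC -!mulrA.
  rewrite big_split /= -!mulr_sumr addrC; exact: is_deriveM.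
have DX i : D (mpolyX R (mnm1 i)).
  rewrite /D /evalc; under eq_fun do rewrite mevalXU.
  rewrite (bigD1 i)//= big1 => [|j ji].
    have U0 : mnm_sub (mnm1 i) (mnm1 i) = mnm0.
      by apply/mnmP => j; rewrite mnmBE subnn mnm0E.
    rewrite mderivX mnm1E eqxx scale1r U0 mpolyX0 meval1 mul1r addr0.
    exact: zw.
  by rewrite mderivX mnm1E eq_sym (negPf ji) scale0r meval0 mul0r.
elim/mpolyind: p => [|c m p _ _ Dp]; first by rewrite -mpolyC0; exact: DC.
apply: (DD) => //; rewrite -mul_mpolyC; apply: (DM); first exact: DC.
have D1 : D 1 by rewrite -mpolyC1; exact: DC.
rewrite mpolyXE_id; elim/big_ind: _ => [|q q'|i _]; [exact: D1|exact: DM|].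
by elim: (m i) => [|k IHk]; [exact: D1|rewrite exprS; exact: DM].
Qed.

(** At a first exit time [t] one would have [m <= V (z t) <= V (z 0) < m], as [V] does not increase
    while the trajectory is in the ball. *)
Lemma lyapunov_invariance F (V : {mpoly R[n]}) (r m T : R) z :
  (forall x, `|x| <= r -> \sum_i evalc (mderiv i V) x * F x i 0 <= 0) ->
  (forall x, `|x| = r -> m <= evalc V x) ->
  0 <= T -> solution_on F `[0, T] z ->
  `|z 0| < r -> evalc V (z 0) < m -> `|z T| < r.
Proof.
move=> VF Vm T0 zT z0r Vz0; rewrite ltNge; apply/negP => rzT.
have zC := solution_on_continuous zT.
have nzC : {within `[0, T], continuous (fun s => `|z s|)}.
  by move=> s; apply: (continuous_comp (zC s)); exact: norm_continuous.
pose S := [set s | 0 <= s <= T /\ r <= `|z s|].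
have ST : S T by split=> //; rewrite T0 lexx.
have Slb : lbound S 0 by move=> s [/andP[]].
have Sinf : has_inf S by split; [exists T|exists 0].
(* t is the first time at which the trajectory leaves the open ball. *)
set t := inf S.
have t0 : 0 <= t by apply: lb_le_inf => //; exists T.
have tT : t <= T by apply: ge_inf => //; exists 0.
have tS s : 0 <= s -> s < t -> `|z s| < r.
  move=> s0 st; rewrite ltNge; apply/negP => rzs.
  have : t <= s.
    by apply: ge_inf; [exists 0|split=> //; rewrite s0 ltW// (lt_le_trans st)].
  by rewrite leNgt st.
(* Otherwise continuity would keep the norm below [r] just after [t], where the infimum has points
   of [S] arbitrarily close. *)
have rzt : r <= `|z t|.
  rewrite leNgt; apply/negP => ztr.
  have /subspace_continuousP/(_ t) := nzC.
  rewrite /= in_itv /= t0 tT => /(_ isT)/cvgr_lt/(_ r ztr).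
  rewrite near_withinE => /nbhs_ballP[d /= d0 dS].
  have [s Ss std] := inf_adherent d0 Sinf.
  have [/andP[s0 sT] rzs] := Ss.
  have ts : t <= s by apply: ge_inf => //; exists 0.
  have : `|z s| < r.
    apply: dS; last by rewrite /= in_itv /= s0.
    by rewrite /ball /= ler0_norm ?subr_le0// opprB ltrBlDr addrC.
  by rewrite ltNge rzs.
(* The value [r] is taken somewhere on [[0, t]] by the intermediate value theorem, and not before
   [t]. *)
have ztr : `|z t| = r.
  have nzCt : {within `[0, t], continuous (fun s => `|z s|)}.
    by apply: continuous_subspaceW nzC; apply: subset_itvl; rewrite bnd_simp.
  have [|c] := IVT t0 nzCt (v := r).
    by rewrite ge_min le_max (ltW z0r) rzt orbT.
  rewrite in_itv /= => /andP[c0 ct] zcr.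
  have : ~~ (c < t) by apply/negP => /(tS c c0); rewrite zcr ltxx.
  by rewrite -leNgt => tc; rewrite -zcr (@le_anti _ _ c t)// ct tc.
suff : evalc V (z t) <= evalc V (z 0).
  by move/(le_trans (Vm _ ztr)); rewrite leNgt Vz0.
have zD s : s \in `]0, t[ -> is_derive s 1 (fun x => evalc V (z x))
    (\sum_i evalc (mderiv i V) (z s) * F (z s) i 0).
  move=> st; apply: is_derive_evalc => i.
  apply: (solution_on_is_derive _ zT).
  by apply: subset_itvl st; rewrite bnd_simp.
have VC : {within `[0, T], continuous (fun s => evalc V (z s))}.
  move=> s; apply: (continuous_comp (zC s)).
  apply: bounded_lipschitz_continuous; apply: bounded_lipschitz_evalc.
  exact: bounded_lipschitz_id.
apply: (@ler0_derive1_le_cc _ (fun x => evalc V (z x)) 0 t).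
- by move=> s /zD[].
- move=> s st; have Ds := zD s st; rewrite derive1E derive_val; apply: VF.
  by move: st; rewrite in_itv /= => /andP[s0 st]; rewrite ltW// tS// ltW.
- by apply: continuous_subspaceW VC; apply: subset_itvl; rewrite bnd_simp.
- by rewrite in_itv /= lexx t0.
- by rewrite in_itv /= lexx t0.
- exact: t0.
Qed.

End Trajectories.

(** * Lyapunov's direct method *)

Section Clipping.
Context {R : realType} {n : nat}.

(** In the maximum norm the cube is the closed ball of radius [r]; coordinatewise truncation is a
    nonexpansive retraction onto it. *)
Definition clip (r : R) (x : 'cV[R]_n) : 'cV[R]_n :=
  map_mx (fun u => Num.max (- r) (Num.min r u)) x.

Lemma clip_norm r x : 0 <= r -> `|clip r x| <= r.
Proof.
move=> r0; apply/mx_norm_leP => // i j; rewrite mxE ler_norml le_max lexx /=.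
by rewrite ge_max ge_min lexx andbT ge0_cp.
Qed.

Lemma clip_id r x : `|x| <= r -> clip r x = x.
Proof.
move=> xr; apply/matrixP => i j; rewrite mxE.
have := le_trans (mx_norm_entry x i j) xr; rewrite ler_norml => /andP[rx xr'].
by rewrite (min_r xr') (max_r rx).
Qed.

Lemma clip_lipschitz r x y : 0 <= r -> `|clip r x - clip r y| <= `|x - y|.
Proof.
move=> r0; apply/mx_norm_leP => // i j; apply: le_trans (mx_norm_entry _ i j).
rewrite !mxE; set u := x i j; set v := y i j.
have := ler_norm (u - v); have := ler_norm (v - u); rewrite (distrC v) => vu uv.
pose c w : R := Num.max (- r) (Num.min r w).
have cP w : [\/ r <= w /\ c w = r, w <= - r /\ c w = - r
    | (- r <= w) && (w <= r) /\ c w = w].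
  rewrite /c; have [rw|wr] := leP r w.
    by apply: Or31; split=> //; rewrite max_r//; lra.
  have [rw|wr'] := leP (- r) w; last by apply: Or32; split=> //; exact: ltW.
  by apply: Or33; split=> //; exact: ltW.
rewrite -/(c u) -/(c v) ler_norml.
by case: (cP u) => -[hu ->]; case: (cP v) => -[hv ->]; apply/andP; split; lra.
Qed.

End Clipping.

(** * Stability from a polynomial Lyapunov function *)

Section LyapunovFunction.
Context {R : realType} {n : nat}.
Variables (F : 'cV[R]_n -> 'cV[R]_n) (V : {mpoly R[n]}).

Lemma clipped_solution r z0 : bounded_lipschitz F -> 0 <= r ->
  exists2 z, z 0 = z0 & solution_on (F \o clip r) `[0, +oo[ z.
Proof.
move=> FL r0; have [B _ FB] := bounded_lipschitz_bounded FL r.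
have [L L0 FrL] := bounded_lipschitz_ge0 FL r.
have FcB x : `|(F \o clip r) x| <= B by apply: FB; exact: clip_norm.
have FcL x y : `|(F \o clip r) x - (F \o clip r) y| <= L * `|x - y|.
  apply: (le_trans (FrL _ _ (clip_norm _ r0) (clip_norm _ r0))).
  by rewrite ler_wpM2l// clip_lipschitz.
exists (euler_lim (F \o clip r) z0); first exact: euler_lim0.
by move=> t; rewrite /= in_itv /= andbT; exact: euler_lim_derive L0 FcB FcL t.
Qed.

Lemma sphere_lower_bound r : 0 < r -> (forall x, x != 0 -> 0 < evalc V x) ->
  exists2 m : R, 0 < m & forall x, `|x| = r -> m <= evalc V x.
Proof.
(* The sphere is transposed to row vectors to match [bounded_closed_compact] and [EVT_min_rV]. *)
move=> r0 V_gt0; pose S := [set v : 'rV[R]_n | `|v^T| = r].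
have VC : continuous (fun v : 'rV[R]_n => evalc V v^T).
  apply: bounded_lipschitz_continuous; apply: bounded_lipschitz_evalc.
  apply: bounded_lipschitz_mx => i j; under eq_fun do rewrite mxE.
  exact: (bounded_lipschitz_entry _ _ (@bounded_lipschitz_id _ _)).
(* In dimension 0 the sphere is empty and any positive [m] will do. *)
have [[v0 Sv0]|S0] := pselect (S !=set0); last first.
  exists 1 => // x xr; case: S0; exists x^T; by rewrite /S /= trmxK.
have SC : compact S.
  apply: bounded_closed_compact.
    exists r; split; first exact: num_real.
    move=> M rM v Sv; apply/mx_norm_leP => [|i j].
      by rewrite ltW// (lt_trans r0).
    have := mx_norm_entry v^T j i; rewrite mxE Sv => /le_trans; apply.
    exact: ltW.
  rewrite (_ : S = (fun v : 'rV[R]_n => `|v^T|) @^-1` [set r])//.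
  apply: closed_comp; last exact: closed_eq.
  move=> v _; apply: (continuous_comp _ (@norm_continuous _ _ _)).
  move: v; apply: bounded_lipschitz_continuous.
  apply: bounded_lipschitz_mx => i j; under eq_fun do rewrite mxE.
  exact: (bounded_lipschitz_entry _ _ (@bounded_lipschitz_id _ _)).
have [||c cS cmin] := @EVT_min_rV _ _ (fun v => evalc V v^T) S _ SC.
- by exists v0.
- exact: continuous_subspaceT.
exists (evalc V c^T).
  apply: V_gt0; rewrite -normr_gt0; move: cS; rewrite inE /S /= => ->.
  exact: r0.
move=> x xr; rewrite -[x]trmxK; apply: cmin.
by rewrite inE /S /= trmxK.
Qed.

Lemma lyapunov_stable_polynomial r0 : bounded_lipschitz F -> 0 < r0 ->
  evalc V 0 = 0 -> (forall x, x != 0 -> 0 < evalc V x) ->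
  (forall x, `|x| <= r0 -> \sum_i evalc (mderiv i V) x * F x i 0 <= 0) ->
  lyapunov_stable F 0.
Proof.
move=> FL r00 V0 V_gt0 VF e e0.
pose r := Num.min e r0.
have r_gt0 : 0 < r by rewrite lt_min e0.
have re : r <= e by rewrite ge_min lexx.
have rr0 : r <= r0 by rewrite ge_min lexx orbT.
have [m m0 Vm] := sphere_lower_bound r_gt0 V_gt0.
have VFr x : `|x| <= r -> \sum_i evalc (mderiv i V) x * F x i 0 <= 0.
  by move=> xr; apply: VF; exact: le_trans rr0.
have VL := bounded_lipschitz_evalc V (@bounded_lipschitz_id R 'cV[R]_n).
have /cvgrPdist_lt/(_ m m0) := bounded_lipschitz_continuous VL (x := 0).
rewrite V0 => /nbhs_norm0P[d /= d0 dV].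
exists (Num.min d r) => [|z0]; first by rewrite lt_min d0.
rewrite subr0 lt_min => /andP[z0d z0r].
have Vz0 : evalc V z0 < m.
  by have := dV z0 z0d; rewrite sub0r normrN; exact/le_lt_trans/ler_norm.
split.
  have [z zz0 zc] := clipped_solution z0 FL (ltW r_gt0).
  exists z => // t t0.
  have ztr : `|z t| < r.
    (* Invariance is applied to the clipped field, which [z] is known to solve and which agrees with
       [F] on the ball; only then does [z] solve the original equation. *)
    apply: (@lyapunov_invariance _ _ (F \o clip r) V r m t z) => //.
    - by move=> x xr; rewrite /= clip_id//; exact: VFr.
    - by move: t0; rewrite /= in_itv /= andbT.
    - apply: solution_on_sub zc => s /=; rewrite !in_itv /= andbT.
      by case/andP.
    - by rewrite zz0.
    - by rewrite zz0.
  by have := zc t t0; rewrite /= clip_id// ltW.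
(* An arbitrary solution on [[0, T[] is restricted to the closed interval [[0, t]], as [t < T]. *)
move=> T z zz0 zT t /andP[t0 tT]; rewrite subr0; apply: lt_le_trans re.
apply: (@lyapunov_invariance _ _ F V r m t z); rewrite ?zz0//.
apply: solution_on_sub zT => s /=; rewrite !in_itv /= => /andP[-> st] /=.
exact: le_lt_trans tT.
Qed.

End LyapunovFunction.

(** * From the sum of squares certificate to stability *)

Theorem proposition2 (R : realType)
  (l : nat) (n : nat -> nat)
  (W : forall k, 'M[R]_(n k.+1, n k)) (b : forall k, 'cV[R]_(n k.+1))
  (phi : R -> R)
  (phi_lip : [locally [lipschitz phi v | v in setT]])
  (f : 'cV[{mpoly R[n 0%N + n l.+1]}]_(n 0%N))
  (f0 : closed_loop W b phi f 0 = 0)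
  (nd : nat) (d : 'I_nd -> {mpoly R[n 0%N]})
  (D0 : nbhs (0 : 'cV[R]_(n 0%N)) (semialg d))
  (np nq : nat)
  (g : 'I_np -> {mpoly R[nX l n]}) (h : 'I_nq -> {mpoly R[nX l n]})
  (g_ge0 : forall z, semialg d z ->
     forall i, 0 <= evalc (g i) (Xpoint l W b phi z))
  (h_eq0 : forall z, semialg d z ->
     forall j, evalc (h j) (Xpoint l W b phi z) = 0)
  (V rho : {mpoly R[n 0%N]})
  (V0 : evalc V 0 = 0) (rho_pd : posdef rho)
  (p : 'I_nd -> {mpoly R[nX l n]}) (s : 'I_np -> {mpoly R[nX l n]})
  (t : 'I_nq -> {mpoly R[nX l n]})
  (p_sos : forall k, sos (p k)) (s_sos : forall i, sos (s i))
  (V_sos : sos (V - rho))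
  (dV_sos : sos (- lie W b f V
                 - \sum_(k < nd) p k * substc (d k) (Xz R l n)
                 - \sum_(j < nq) t j * h j
                 - \sum_(i < np) s i * g i)) :
  lyapunov_stable (closed_loop W b phi f) 0.
Proof.
have V_gt0 x : x != 0 -> 0 < evalc V x.
  move=> x0; have [_ /(_ x x0) rhox] := rho_pd.
  have := evalc_sos_ge0 x V_sos; rewrite /evalc mevalB subr_ge0.
  exact: lt_le_trans.
have /nbhs_norm0P[r /= r0 rD] := D0.
(* Halving the radius puts a closed ball inside the open ball contained in the region. *)
apply: (@lyapunov_stable_polynomial _ _ _ V (r / 2)) => //.
- exact/bounded_lipschitz_closed_loop/bounded_lipschitz_locally.
- by rewrite divr_gt0.
move=> x xr; have Dx : semialg d x by apply: rD; rewrite /=; lra.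
rewrite -evalc_lie -oppr_ge0.
set X := Xpoint l W b phi x.
have := evalc_sos_ge0 X dV_sos.
rewrite /evalc !mevalB mevalN -!/(evalc _ _) !subr_ge0.
have Xx : \col_i evalc (Xz R l n i 0) X = x.
  exact: (evalc_Xlayer W b phi x ord0).
have pd : 0 <= evalc (\sum_(k < nd) p k * substc (d k) (Xz R l n)) X.
  rewrite /evalc rmorph_sum /=; apply: sumr_ge0 => k _.
  rewrite mevalM -!/(evalc _ _) evalc_substc Xx.
  by apply: mulr_ge0; [exact: evalc_sos_ge0|exact: Dx].
have th : evalc (\sum_(j < nq) t j * h j) X = 0.
  rewrite /evalc rmorph_sum /=; apply: big1 => j _.
  by rewrite mevalM -!/(evalc _ _) h_eq0// mulr0.
have sg : 0 <= evalc (\sum_(i < np) s i * g i) X.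
  rewrite /evalc rmorph_sum /=; apply: sumr_ge0 => i _.
  rewrite mevalM -!/(evalc _ _).
  by apply: mulr_ge0; [exact: evalc_sos_ge0|exact: g_ge0].
(* The certificate now says that the [s i * g i] sum is at most minus the Lie derivative minus the
   [p k * d k] sum; both sums are nonnegative. *)
rewrite th subr0 => le1; have := le_trans sg le1; rewrite subr_ge0.
exact: le_trans.
Qed.
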